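(* Fix integers $q\ge 2$ and $R\ge 1$. As $n\to\infty$, the minimum length $\mathcal{L}_q(n,R)$ of a $q$-ary $(n,R)$-covering sequence satisfies $$\mathcal{L}_q(n,R)\le\left(2q^R R^{R+1}+o_{q,R}(1)\right)\frac{q^n}{n^R}=\left(\frac{2q^R(q-1)^R R^{R+1}}{R!}+o_{q,R}(1)\right)\frac{q^n}{V_q(n,R)}.$$ Here the displayed equality means that both upper bounds hold, each with its own error term $o_{q,R}(1)$.
   Context: The alphabet is $\Sigma_q=\mathbb{Z}_q=\mathbb{Z}/q\mathbb{Z}$. A cyclic sequence of length $\ell\ge 1$ is a tuple $A=(a_t)_{t\in\mathbb{Z}_\ell}$ with $a_t\in\Sigma_q$, with indices read modulo $\ell$. For an integer $j$ and a positive integer $u$, the cyclic window of length $u$ starting at phase $j$ is $A[j,u]=(a_j,a_{j+1},\ldots,a_{j+u-1})\in\Sigma_q^u$, with subscripts reduced modulo $\ell$ ($u$ may exceed $\ell$, in which case the sequence is read periodically). $d_{\mathrm H}$ denotes Hamming distance. A cyclic sequence $S$ over $\Sigma_q$ is a $q$-ary $(n,R)$-covering sequence if for every $y\in\Sigma_q^n$ there is a phase $j$ with $d_{\mathrm H}(y,S[j,n])\le R$. $\mathcal{L}_q(n,R)$ is the smallest length of such a cyclic sequence. $V_q(n,R)=\sum_{j=0}^{R}\binom{n}{j}(q-1)^j$ is the size of a Hamming ball of radius $R$ in $\Sigma_q^n$. The notation $o_{q,R}(1)$ denotes a quantity tending to $0$ as $n\to\infty$ at a rate that depends only on $q$ and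 $R$. *)

(* Defs.v *)
From mathcomp Require Import all_boot all_order all_algebra.
From mathcomp Require Import boolp.

Set Implicit Arguments.
Unset Strict Implicit.
Unset Printing Implicit Defensive.

Import Order.TTheory GRing.Theory Num.Theory.

Local Open Scope nat_scope.

Definition hamming_dist (T : eqType) (n : nat) (x y : n.-tuple T) : nat :=
  #|[set i : 'I_n | tnth x i != tnth y i]%SET|.

(* The alphabet Z/qZ is ['Z_q], which has q elements only for [2 <= q].
   Subscripts are reduced modulo [l] (least nonnegative residue); when [0 < l]
   the reduced subscript is below [l], so the default value of [nth] is never
   returned. *)
Definition window (q l : nat) (A : l.-tuple 'Z_q) (j : int) (u : nat) :
    u.-tuple 'Z_q :=
  [tuple nth 0%R A `|((j + i%:Z)%R %% l)%Z|%N | i < u].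

Definition covering_sequence (q n R l : nat) (S : l.-tuple 'Z_q) : Prop :=
  forall y : n.-tuple 'Z_q,
    exists j : int, hamming_dist y (window S j n) <= R.

Definition covering_length (q n R l : nat) : Prop :=
  0 < l /\ exists S : l.-tuple 'Z_q, covering_sequence n R S.

(* The concatenation of all words of length [n], padded by one symbol so that
   it is nonempty also when [n = 0]. *)
Lemma covering_length_exists (q n R : nat) :
  exists l, `[< covering_length q n R l >].
Proof.
pose ws := [seq tval w | w <- enum {: n.-tuple 'Z_q}].
pose s := rcons (flatten ws) 0%R.
exists (size s); apply/asboolP; split; first by rewrite size_rcons.
exists (in_tuple s) => y.
have : tval y \in ws by apply: map_f; rewrite mem_enum.
case/splitPr def_ws: ws / => [w1 w2].
have def_s : s = flatten w1 ++ (y ++ rcons (flatten w2) 0%R).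
  by rewrite /s def_ws flatten_cat /= -!cats1 -!catA.
exists (Posz (size (flatten w1))).
rewrite /hamming_dist eq_card0 // => i; rewrite !inE; apply/negbTE/negPn/eqP.
rewrite tnth_mktuple.
have lt_i : size (flatten w1) + i < size s.
  rewrite def_s !size_cat ltn_add2l size_tuple.
  exact: leq_trans (ltn_ord i) (leq_addr _ _).
rewrite -PoszD modz_small ?ltz_nat // absz_nat /= def_s.
rewrite nth_cat ltnNge leq_addr /= addKn nth_cat size_tuple ltn_ord.
by rewrite (tnth_nth 0%R).
Qed.

Definition min_covering_length (q n R : nat) : nat :=
  ex_minn (covering_length_exists q n R).

(* Cardinality of a Hamming ball of radius [R] in a space of words of length
   [n] over [q] letters; terms with [n < j] vanish. *)
Definition hamming_ball_size (q n R : nat) : nat :=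
  \sum_(j < R.+1) 'C(n, j) * (q - 1) ^ j.

(* Main.v *)
Require Import Defs.
From mathcomp Require Import all_boot all_order all_algebra all_fingroup.
From mathcomp Require Import all_classical all_reals all_analysis.
From mathcomp Require Import zify ring.

Set Implicit Arguments.
Unset Strict Implicit.
Unset Printing Implicit Defensive.

Import Order.TTheory GRing.Theory Num.Theory.
Import numFieldNormedType.Exports.

(** Given [n], let [r] be the largest exponent with [R * (q ^ r + 2 * r) <= n],
    put [u := n - R * r], and consider all sequences over Z/q that satisfy a
    linear recurrence
      [s_(t+u) = s_t - \sum_(0 < j < u) c_j s_(t+j)].
    A window of length [n] of such a sequence is exactly a word killed by the
    [R * r] parity checks given by the shifts of the recurrence.  Take [c]
    supported on the multiples of [R], where it spells a word that contains
    every [r]-tuple (a de Bruijn word, of length about [q ^ r]).  The columns of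
    the parity-check matrix then split into [R] residue classes, those of class
    [a] act only on the checks [t] with [t = a] modulo [R], and they run through
    all of (Z/q)^r.  Adding 1 to one well-chosen letter per class thus cancels
    any syndrome, so every word of length [n] is within distance [R] of a window
    ([exists_covering_recurrence]).

    The recurrence is an invertible map on the [q ^ u] states, so its solutions
    fall into periodic orbits.  Unrolling each orbit [O] into a word of length
    [#|O| + n] and concatenating these words gives a covering sequence of length
    [q ^ u + n * (number of orbits)] ([min_covering_length_shift_perm]).  Since
    a state of period [p] is determined by [p] letters, at most [q ^ p] states
    have period dividing [p]; almost all orbits are therefore longer than
    [P := u - 3 * r], and there are at most about [q ^ u / P] of them
    ([card_porbits_shift]).  As [P] is asymptotic to [n], the total length is
    [(2 + o(1)) * q ^ u], and [q ^ (u - n) = (q ^ r) ^- R], where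
    [q ^ r >= n / (q * R) * (1 - o(1))] by the choice of [r].  This yields
    the constant [2 * q ^ R * R ^ R], which is at most the required one.

    The second bound follows because the size of the ball is at most
    [n ^ R * ((q - 1) ^ R / R! + O(1 / n))]. *)

Local Open Scope nat_scope.

(** * Shift permutations and their output streams *)

Definition debruijn_edge (T : finType) (u : nat) (x y : u.-tuple T) : bool :=
  behead x == take u.-1 y.

Definition shift_perm (T : finType) (u : nat) (s : {perm u.-tuple T}) : Prop :=
  forall x, debruijn_edge x (s x).

Definition stream (T : finType) (x0 : T) (u : nat) (s : {perm u.-tuple T})
    (x : u.-tuple T) (t : nat) : T :=
  head x0 (iter t s x).

Lemma nth_debruijn_edge (T : finType) (x0 : T) (u : nat) (x y : u.-tuple T)
    (i : nat) :
  debruijn_edge x y -> i.+1 < u -> nth x0 y i = nth x0 x i.+1.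
Proof.
move=> /eqP xy iu; rewrite -nth_behead xy nth_take //.
by case: u iu {x y xy}.
Qed.

Lemma stream_nth (T : finType) (x0 : T) (u : nat) (s : {perm u.-tuple T})
    (x : u.-tuple T) (t i : nat) :
  shift_perm s -> i < u -> nth x0 (iter t s x) i = stream x0 s x (t + i).
Proof.
move=> hs; elim: i t => [|i IH] t iu; first by rewrite addn0 /stream nth0.
rewrite addnS -addSn -IH ?(ltnW iu) //= [RHS](@nth_debruijn_edge _ x0 _ (iter t s x)) //.
Qed.

Lemma stream_inj (T : finType) (x0 : T) (u : nat) (s : {perm u.-tuple T})
    (x y : u.-tuple T) :
  shift_perm s -> stream x0 s x =1 stream x0 s y -> x = y.
Proof.
move=> hs e; apply: val_inj; apply: (@eq_from_nth _ x0) => [|i].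
  by rewrite !size_tuple.
rewrite size_tuple => iu.
by rewrite (@stream_nth _ x0 _ s x 0) // (@stream_nth _ x0 _ s y 0).
Qed.

(** Invertibility comes from the form of the feedback: the letter leaving the
    register enters it through an added summand, so it can be recovered from the
    new letter and the letters that stay. *)
Lemma exists_shift_register (T : finZmodType) (u : nat) (f : seq T -> T) :
  0 < u ->
  exists s : {perm u.-tuple T}, forall x : u.-tuple T,
    s x = rcons (behead x) (head 0%R x + f (behead x))%R :> seq T.
Proof.
case: u => // u _.
pose F (x : u.+1.-tuple T) : u.+1.-tuple T :=
  [tuple of rcons (behead x) (head 0%R x + f (behead x))%R].
have F_inj : injective F.
  move=> x y /(congr1 val) /= /rcons_inj [].
  case/tupleP: x => a x; case/tupleP: y => b y /= exy.
  by have -> : x = y by [apply: val_inj]; move=> /addIr ->.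
by exists (perm F_inj) => x; rewrite permE.
Qed.

Lemma rcons_debruijn_edge (T : finType) (u : nat) (x y : u.-tuple T) (c : T) :
  y = rcons (behead x) c :> seq T -> debruijn_edge x y.
Proof.
move=> e; rewrite /debruijn_edge e -cats1 take_size_cat //.
by rewrite size_behead size_tuple.
Qed.

(** * De Bruijn words *)

(** Every state [y] reached by an edge from [x] is the image under [s] of a
    state with the same tail as [x], and that state lies in the orbit of [x]. *)
Lemma porbit_edge_closed (T : finType) (u : nat) (s : {perm u.-tuple T}) :
  shift_perm s ->
  (forall x y : u.-tuple T, behead x = behead y -> y \in porbit s x) ->
  forall x y : u.-tuple T, debruijn_edge x y -> y \in porbit s x.
Proof.
move=> hs htwin x y exy.
have ey := hs ((s^-1)%g y); rewrite permKV in ey.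
have := htwin x ((s^-1)%g y) _.
rewrite (eqP exy) (eqP ey) => /(_ erefl).
rewrite -eq_porbit_mem => /eqP <-.
by have := mem_porbit s 1 ((s^-1)%g y); rewrite expg1 permKV.
Qed.

(** From [x] any [w] is reached by shifting in the letters of [w] one by one:
    the states on the way are the windows of [x ++ w]. *)
Lemma debruijn_connected (T : finType) (u : nat) (O : u.-tuple T -> Prop) :
  (forall x y, O x -> debruijn_edge x y -> O y) -> forall x w, O x -> O w.
Proof.
case: u O => [|u] O hO x w Ox; first by rewrite (tuple0 w) -(tuple0 x).
pose x0 := thead x.
pose v i : u.+1.-tuple T := [tuple nth x0 (x ++ w) (i + j) | j < u.+1].
have nthv i j : j < u.+1 -> nth x0 (v i) j = nth x0 (x ++ w) (i + j).
  by move=> ju; rewrite -(tnth_nth x0 (v i) (Ordinal ju)) tnth_mktuple.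
have v0 : v 0 = x.
  apply: val_inj; apply: (@eq_from_nth _ x0) => [|j]; first by rewrite !size_tuple.
  by rewrite size_tuple => ju; rewrite nthv // nth_cat size_tuple ju.
have vu : v u.+1 = w.
  apply: val_inj; apply: (@eq_from_nth _ x0) => [|j]; first by rewrite !size_tuple.
  rewrite size_tuple => ju; rewrite nthv // nth_cat size_tuple.
  by rewrite ltnNge leq_addr /= addKn.
rewrite -vu; elim: u.+1 => [|i IH]; first by rewrite v0.
apply: hO IH _; rewrite /debruijn_edge; apply/eqP.
apply: (@eq_from_nth _ x0) => [|j].
  by rewrite size_behead size_takel ?size_tuple.
rewrite size_behead size_tuple /= => ju.
by rewrite nth_behead nth_take // !nthv ?ltnS ?(ltnW ju) // addnS.
Qed.

(** A shift permutation with the fewest orbits has a single one.  If two states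
    with the same tail were in different orbits, exchanging their successors
    would give a shift permutation in which these two orbits are merged; so
    states with the same tail share their orbit, and orbits are closed under all
    edges of a connected graph. *)
Lemma exists_debruijn_perm (T : finZmodType) (u : nat) :
  0 < u -> exists2 s : {perm u.-tuple T}, shift_perm s &
    forall x w, w \in porbit s x.
Proof.
move=> u0.
(* With zero feedback the register is the cyclic rotation of words. *)
have [s0 hs0] := exists_shift_register (fun=> 0%R : T) u0.
pose P (s : {perm u.-tuple T}) := [forall x, debruijn_edge x (s x)].
have P0 : P s0 by apply/forallP => x; apply: rcons_debruijn_edge (hs0 x).
case: (@arg_minnP _ s0 P (fun s => #|porbits s|) P0) => s /forallP hs smin.
exists s => // x w; apply: (debruijn_connected (O := fun z => z \in porbit s x)) (porbit_id s x) => {w} y z.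
rewrite -eq_porbit_mem => /eqP <-; apply: porbit_edge_closed => // {x} {}y {}z yz.
rewrite porbit_sym; apply/negPn/negP => nyz.
have := porbits_mul_tperm s y z; rewrite nyz /=.
have -> : y != z by apply: contra nyz => /eqP ->; rewrite porbit_id.
suff /smin : P (tperm y z * s)%g.
  move=> le e; have := leq_add le (leqnn 2).
  by rewrite -[X in _ + X]/(true.*2) e leq_add2l.
apply/forallP => x; rewrite permM.
by case: tpermP => [-> | -> | _ _] //; rewrite /debruijn_edge (yz, esym yz);
  apply: hs.
Qed.

Lemma exists_debruijn_word (T : finZmodType) (u : nat) :
  0 < u -> exists h : nat -> T, forall w : nat -> T,
    exists2 i, i < #|T| ^ u & forall b, b < u -> h (i + b) = w b.
Proof.
move=> u0; have [s hs str] := exists_debruijn_perm T u0.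
pose x : u.-tuple T := [tuple 0%R | _ < u].
exists (stream 0%R s x) => w; pose y := [tuple w i | i < u].
have := str x y; rewrite porbit_traject => /trajectP[i].
have -> : porbit s x = [set: u.-tuple T]%SET by apply/setP => z; rewrite inE str.
rewrite cardsT card_tuple => iT ey; exists i => // b bu.
by rewrite -stream_nth // -ey -[LHS](tnth_nth _ _ (Ordinal bu)) tnth_mktuple.
Qed.

(** * Counting the orbits of a shift permutation *)
Lemma sum_card_porbits (T : finType) (s : {perm T}) :
  \sum_(A in porbits s) #|A| = #|T|.
Proof.
rewrite -sum1_card (partition_big (porbit s) (mem (porbits s))) /=; last first.
  by move=> x _; apply: imset_f.
apply: eq_bigr => A /imsetP[x _ ->]; rewrite -sum1_card.
by apply: eq_bigl => y; rewrite -eq_porbit_mem.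
Qed.

(** The first [p] letters of a stream of period [p] determine it. *)
Lemma card_periodic (T : finType) (x0 : T) (u : nat) (s : {perm u.-tuple T})
    (p : nat) :
  shift_perm s -> 0 < p -> #|[set x | iter p s x == x]%SET| <= #|T| ^ p.
Proof.
move=> hs p0; rewrite -{2}(card_ord p) -card_ffun.
pose f (x : u.-tuple T) := [ffun i : 'I_p => stream x0 s x i].
rewrite -(@card_in_imset _ _ f); first exact: max_card.
move=> x y; rewrite !inE => /eqP px /eqP py exy.
have per z t : iter p s z = z -> stream x0 s z t = stream x0 s z (t %% p).
  move=> pz; rewrite {1}(divn_eq t p) addnC; elim: (t %/ p) => [|k IH].
    by rewrite addn0.
  by rewrite mulSn addnCA -IH /stream addnC iterD pz.
apply: (stream_inj (x0 := x0) hs) => t; rewrite per // [RHS]per //.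
have tp : t %% p < p by rewrite ltn_mod.
by have := congr1 (fun g : {ffun 'I_p -> T} => g (Ordinal tp)) exy; rewrite !ffunE.
Qed.

(** The orbits longer than [P] are at most [#|T| ^ u / P] in number since they
    are disjoint; each of the others contains a state of period at most [P], and
    these are few by [card_periodic].  The inequality is multiplied by [P] to
    avoid division. *)
Lemma card_porbits_shift (T : finType) (x0 : T) (u : nat)
    (s : {perm u.-tuple T}) (P : nat) :
  shift_perm s -> P * #|porbits s| <= #|T| ^ u + P * (P * #|T| ^ P).
Proof.
move=> hs.
pose short := [set A in porbits s | #|A| <= P]%SET.
have le_short : #|short| <= P * #|T| ^ P.
  pose per := [set x | [exists p : 'I_P, iter p.+1 s x == x]]%SET.
  have short_sub : short \subset (porbit s @: per)%SET.
    apply/fintype.subsetP => A; rewrite inE => /andP[/imsetP[x _ ->] leP].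
    apply: imset_f; rewrite inE.
    case e: #|porbit s x| leP => [|p] leP; first by have := card_porbit_neq0 s x; rewrite e.
    by apply/existsP; exists (Ordinal leP); rewrite -[(Ordinal leP).+1]/(p.+1) -e iter_porbit.
  apply: leq_trans (subset_leq_card short_sub) _.
  apply: leq_trans (leq_imset_card _ _) _.
  have per_sub : per \subset (\bigcup_(p < P) [set x | iter p.+1 s x == x])%SET.
    by apply/fintype.subsetP => x; rewrite inE => /existsP[p xp]; apply/bigcupP; exists p; rewrite ?inE.
  apply: leq_trans (subset_leq_card per_sub) _.
  rewrite -[X in _ <= X * _]card_ord -sum_nat_const.
  apply: (big_rec2 (fun (A : {set u.-tuple T}) k => #|A| <= k)).
    by rewrite cards0.
  move=> p k A _ leAk; apply: leq_trans (leq_card_setU _ _).1 (leq_add _ leAk).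
  apply: leq_trans (card_periodic x0 hs (ltn0Sn p)) _.
  by rewrite leq_pexp2l //; apply/card_gt0P; exists x0.
rewrite mulnC -sum_nat_const.
rewrite -(card_tuple u T) -(sum_card_porbits s).
apply: leq_trans (leq_add (leqnn _) (leq_mul (leqnn P) le_short)).
rewrite [P * _]mulnC -sum_nat_const /short.
rewrite [X in _ + X](eq_bigl (fun A => (A \in porbits s) && (#|A| <= P))); last first.
  by move=> A; rewrite inE.
rewrite [X in _ + X]big_mkcondr /= -big_split /=; apply: leq_sum => A _.
case: (leqP #|A| P) => [_|/ltnW]; first exact: leq_addl.
by rewrite addn0.
Qed.

(** * From a shift permutation to a covering sequence *)
Lemma min_covering_length_infix (q n R : nat) (s : seq 'Z_q) :
  0 < size s ->
  (forall y : n.-tuple 'Z_q,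
     exists2 z : n.-tuple 'Z_q, infix z s & hamming_dist y z <= R) ->
  min_covering_length q n R <= size s.
Proof.
move=> s0 hs; rewrite /min_covering_length; case: ex_minnP => m _; apply.
apply/asboolP; split=> //; exists (in_tuple s) => y.
have [z /infixP[s1 [s2 def_s]] yz] := hs y.
exists (Posz (size s1)); congr (_ <= R): yz; congr hamming_dist.
apply: eq_from_tnth => i; rewrite tnth_mktuple (tnth_nth 0%R).
have lt_i : size s1 + i < size s.
  by rewrite def_s !size_cat ltn_add2l size_tuple (leq_trans (ltn_ord i)) // leq_addr.
rewrite -PoszD modz_small ?ltz_nat // absz_nat /= def_s.
by rewrite nth_cat ltnNge leq_addr /= addKn nth_cat size_tuple ltn_ord.
Qed.

(** An orbit is periodic, so all windows of length [n] of its streams occur in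
    one stretch of length its cardinality plus [n].  The covering sequence is the
    concatenation of such stretches, one per orbit. *)
Lemma min_covering_length_shift_perm (q n R u : nat) (s : {perm u.-tuple 'Z_q}) :
  0 < n ->
  (forall y : n.-tuple 'Z_q, exists x : u.-tuple 'Z_q,
     hamming_dist y [tuple stream 0%R s x i | i < n] <= R) ->
  min_covering_length q n R <= #|'Z_q| ^ u + n * #|porbits s|.
Proof.
move=> n0 hs.
pose rep (A : {set u.-tuple 'Z_q}) := odflt [tuple 0%R | _ < u] [pick x in A].
pose word A := mkseq (stream 0%R s (rep A)) (#|A| + n).
pose W := flatten [seq word A | A <- enum (porbits s)].
have word_infix x : infix [tuple stream 0%R s x i | i < n] W.
  pose A := porbit s x; have xA : x \in A := porbit_id s x.
  have rA : rep A \in A.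
    by rewrite /rep; case: pickP => [//|/(_ x)]; rewrite xA.
  have : x \in porbit s (rep A) by rewrite porbit_sym.
  rewrite porbit_traject => /trajectP[i].
  have -> : porbit s (rep A) = A by apply/eqP; rewrite eq_porbit_mem.
  move=> iA def_x.
  have AW : word A \in [seq word A | A <- enum (porbits s)].
    by apply: map_f; rewrite mem_enum imset_f.
  have : infix (word A) W.
    rewrite /W; case/splitPr: AW => w1 w2; rewrite flatten_cat /=.
    by apply/infixP; exists (flatten w1), (flatten w2).
  apply: infix_trans.
  have -> : [tuple stream 0%R s x i | i < n] = [seq stream 0%R s (rep A) j | j <- iota i n] :> seq 'Z_q.
    apply: (@eq_from_nth _ 0%R) => [|j]; first by rewrite size_tuple size_map size_iota.
    rewrite size_tuple => jn; rewrite -[LHS](tnth_nth _ _ (Ordinal jn)) tnth_mktuple /=.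
    rewrite (nth_map 0) ?size_iota // nth_iota // /stream addnC iterD.
    by rewrite -def_x.
  rewrite /word /mkseq; have -> : #|A| + n = i + (n + (#|A| - i)).
    by rewrite addnCA subnKC ?(ltnW iA) // addnC.
  rewrite !iotaD !map_cat add0n; exact: infix_infix.
have sizeW : size W = #|'Z_q| ^ u + n * #|porbits s|.
  rewrite size_flatten /shape -map_comp sumnE big_map big_enum /=.
  under eq_bigr do rewrite size_mkseq.
  by rewrite big_split /= sum_nat_const sum_card_porbits card_tuple mulnC.
rewrite -sizeW; apply: min_covering_length_infix.
  rewrite sizeW addn_gt0 expn_gt0; apply/orP; left; apply/orP; left.
  by apply/card_gt0P; exists 0%R.
by move=> y; have [x hx] := hs y; eexists; first exact: (word_infix x).
Qed.

(** * A linear recurrence whose windows have covering radius R *)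
Lemma stream_recurrence (T : finZmodType) (u n : nat) (s : {perm u.-tuple T})
    (f : seq T -> T) (z : nat -> T) :
  0 < u ->
  (forall x : u.-tuple T,
     s x = rcons (behead x) (head 0%R x + f (behead x))%R :> seq T) ->
  (forall t, t + u < n ->
     z (t + u) = (z t + f (mkseq (fun j => z (t + j.+1)) u.-1))%R) ->
  forall j, j < n -> stream 0%R s [tuple z i | i < u] j = z j.
Proof.
move=> u0 sE zE.
have hs : shift_perm s by move=> x; apply: rcons_debruijn_edge (sE x).
set x := [tuple z i | i < u]; elim/ltn_ind => j IH jn.
have [ju|uj] := ltnP j u.
  by rewrite -[j]add0n -stream_nth // -[LHS](tnth_nth _ x (Ordinal ju)) tnth_mktuple.
have [t def_j] : exists t, j = t + u by exists (j - u); rewrite subnK.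
subst j; rewrite zE //.
have -> : t + u = t.+1 + u.-1 by rewrite addSnnS prednK.
rewrite -stream_nth ?prednK //= sE nth_rcons size_behead size_tuple ltnn eqxx.
rewrite -/(stream 0%R s x t) IH; try lia.
congr (_ + f _)%R; apply: (@eq_from_nth _ 0%R) => [|j].
  by rewrite size_behead size_mkseq size_tuple.
rewrite size_behead size_tuple => ju.
rewrite nth_behead nth_mkseq // stream_nth //; last lia.
by rewrite IH //; lia.
Qed.

(** The recurrence is [z_(t+u) = z_t - \sum_(0 < j < u) c_j z_(t+j)], and [syn]
    below is the defect of [y] in it.  Incrementing the letter of [y] at a position
    [p] with [R * r <= p < u] changes the defect at [t < R * r] by [c_(p-t)] only:
    such a position meets neither the term [z_t] nor the term [z_(t+u)].  As [c]
    vanishes off the multiples of [R], only the [t] in the residue class of [p]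
    are affected, and [p a] is the position at which the de Bruijn word spells
    the opposite of the defect along the class of [a]. *)
Lemma exists_covering_recurrence (T : finComNzRingType) (R r u : nat) :
  0 < R -> 0 < r -> R * (#|T| ^ r + r) <= u ->
  exists f : seq T -> T, forall y : nat -> T, exists p : nat -> nat,
    let z j := (y j + (j == p (j %% R)%N)%:R)%R in
    forall t, t < R * r ->
      z (t + u) = (z t + f (mkseq (fun j => z (t + j.+1)%N) u.-1))%R.
Proof.
move=> R0 r0 leu; have [h hh] := exists_debruijn_word T r0.
set N := #|T| ^ r in leu hh.
pose c j : T := if R %| j then h (j %/ R).-1 else 0%R.
pose f (w : seq T) : T := (- \sum_(j < u.-1) c j.+1 * w`_j)%R.
exists f => y.
pose syn t : T := (y (t + u)%N - y t + \sum_(j < u.-1) c j.+1 * y (t + j.+1)%N)%R.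
(* The window of [h] that corresponds to a column of the parity-check matrix is
   read backwards, hence the reversed index [r.-1 - b]. *)
have /choice[i hi] : forall a, exists i, i < N /\
    forall b, b < r -> h (i + b) = (- syn (a + R * (r.-1 - b))%N)%R.
  by move=> a; have [i iN hi] := hh (fun b => (- syn (a + R * (r.-1 - b))%N)%R); exists i.
pose p a := a + R * (i a + r); exists p => z t tRr.
have p_lt a : a < R -> p a < u.
  move=> aR; apply: leq_trans leu.
  have [iN _] := hi a.
  have : R * (i a + r).+1 <= R * (N + r) by rewrite leq_mul2l; lia.
  by rewrite /p mulnS; lia.
have p_gt a : t < p a.
  by rewrite /p mulnDr; lia.
set a := t %% R; set b := t %/ R.
have def_t : t = a + R * b by rewrite {1}(divn_eq t R) mulnC addnC.
have br : b < r by rewrite ltn_divLR // mulnC.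
have aR : a < R by rewrite ltn_mod.
have -> : z (t + u) = y (t + u).
  rewrite /z; case: eqP => [e|_]; last by rewrite addr0.
  have := p_lt _ (ltn_pmod (t + u) R0); rewrite -e; lia.
have -> : z t = y t.
  by rewrite /z; case: eqP => [e|_]; [have := p_gt a; rewrite {1}e ltnn | rewrite addr0].
(* Among the increments only the one at [p a] meets a nonzero coefficient. *)
have zsum : (\sum_(j < u.-1) c j.+1 * (mkseq (fun j => z (t + j.+1)%N) u.-1)`_j =
    \sum_(j < u.-1) c j.+1 * y (t + j.+1)%N - syn t)%R.
  under eq_bigr => j _ do rewrite nth_mkseq // /z mulrDr.
  rewrite big_split /=; congr (_ + _)%R.
  have j0u : (p a - t).-1 < u.-1 by have := p_lt a aR; have := p_gt a; lia.
  rewrite (bigD1 (Ordinal j0u)) //= big1 => [|j /eqP neq_j].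
    have -> : (p a - t).-1.+1 = p a - t by have := p_gt a; lia.
    rewrite subnKC; last exact: ltnW.
    have -> : p a %% R = a by rewrite /p addnC mulnC modnMDl modn_small.
    have e : p a - t = (i a + r - b) * R.
      rewrite {1}def_t /p subnDl -mulnBr mulnC //.
    rewrite eqxx mulr1 addr0 /c e dvdn_mull // mulnK //.
    have -> : (i a + r - b).-1 = i a + (r.-1 - b) by lia.
    have [_ ->] := hi a; last by lia.
    by congr (- syn _)%R; rewrite [RHS]def_t; congr (_ + _ * _); lia.
  rewrite /c; case: ifP => [dvd_j|_]; last by rewrite mul0r.
  case: eqP => [e|_]; last by rewrite mulr0.
  case: neq_j; apply: val_inj => /=; move: e.
  have -> : (t + j.+1) %% R = a by rewrite -modnDmr (eqP dvd_j) addn0.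
  by lia.
by rewrite /f zsum /syn; ring.
Qed.

(** There is at most one modified position in each residue class modulo [R]. *)
Lemma hamming_dist_shift (q R n : nat) (y : n.-tuple 'Z_q) (p : nat -> nat) :
  0 < R ->
  hamming_dist y
    [tuple (y`_i + (nat_of_ord i == p (i %% R)%N)%:R)%R | i < n] <= R.
Proof.
move=> R0; rewrite /hamming_dist -[X in _ <= X]card_ord.
pose f (i : 'I_n) : 'I_R := Ordinal (ltn_pmod i R0).
apply: (@leq_card_in _ _ f) => i j; rewrite !inE !tnth_mktuple !(tnth_nth 0%R).
case: (nat_of_ord i =P _) => [ei _|]; last by rewrite addr0 eqxx.
case: (nat_of_ord j =P _) => [ej _|]; last by rewrite addr0 eqxx.
by move=> /(congr1 val) /= e; apply: val_inj; rewrite /= ei ej e.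
Qed.

Lemma min_covering_length_bound (q R r n P : nat) :
  1 < q -> 0 < R -> 0 < r -> R * (q ^ r + r.*2) <= n ->
  P * min_covering_length q n R
    <= P * q ^ (n - R * r) + n * (q ^ (n - R * r) + P * (P * q ^ P)).
Proof.
move=> q1 R0 r0 len; set u := n - R * r.
have cardT : #|'Z_q| = q by rewrite card_ord Zp_cast.
have leu : R * (#|'Z_q| ^ r + r) <= u by rewrite cardT; move: len; rewrite /u; nia.
have u0 : 0 < u.
  apply: leq_trans leu; rewrite muln_gt0 R0 addn_gt0 r0 orbT //.
have [f hf] := exists_covering_recurrence R0 r0 leu.
have [s sE] := exists_shift_register f u0.
have hs : shift_perm s by move=> x; apply: rcons_debruijn_edge (sE x).
have cov : min_covering_length q n R <= #|'Z_q| ^ u + n * #|porbits s|.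
  apply: min_covering_length_shift_perm => [|y]; first by rewrite /u in u0; lia.
  have [p hp] := hf (nth 0%R y).
  set z := fun _ => _ in hp.
  exists [tuple z i | i < u].
  congr (_ <= R): (hamming_dist_shift y p R0); congr hamming_dist.
  apply: eq_from_tnth => i; rewrite !tnth_mktuple.
  rewrite (@stream_recurrence _ u n s f z) // => t tu.
  by apply: hp; move: tu; rewrite /u; lia.
have := card_porbits_shift (0%R : 'Z_q) P hs; rewrite cardT => orb.
apply: leq_trans (leq_mul (leqnn P) cov) _; rewrite cardT.
by rewrite mulnDr leq_add2l mulnCA leq_mul2l orb orbT.
Qed.

(** * Asymptotics *)

Local Open Scope classical_set_scope.
Local Open Scope ring_scope.

(** Here [X] bounds [n / q ^ r] when [r] is the block exponent of [n], and
    [1 - (R + 3) * x] bounds [P / n] from below for [P := n - (R + 3) * r]; the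
    last two terms of the second factor are the shares of the long and of the
    short orbits. *)
Definition density_majorant (K : realType) (q R r : nat) : K :=
  let x := r%:R / q%:R ^+ r in
  let y := q%:R^-1 ^+ r in
  let X := R%:R * (q%:R + 2 * x + 2 * y) in
  X ^+ R * (1 + (1 - (R + 3)%:R * x)^-1 + X ^+ 2 * y).

(** [min_covering_length_bound] with [P := n - (R + 3) * r], which is [3 * r]
    less than the number of letters of a state: the short orbits then contribute
    a fraction of order [n ^ 2 / q ^ (3 * r)], which is of order [q ^ - r]. *)
Lemma density_le_majorant (K : realType) (q R r n : nat) :
  (1 < q)%N -> (0 < R)%N -> (0 < r)%N ->
  (R * (q ^ r + r.*2) <= n)%N -> (n < R * (q ^ r.+1 + r.+1.*2))%N ->
  (R + 3)%:R * (r%:R / q%:R ^+ r) < 1 :> K ->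
  (min_covering_length q n R)%:R * n%:R ^+ R / q%:R ^+ n
    <= density_majorant K q R r.
Proof.
move=> q1 R0 r0 len ltn; rewrite /density_majorant.
set x := r%:R / q%:R ^+ r; set y := q%:R^-1 ^+ r.
set X := R%:R * _ => x_small.
have q0 : 0 < q%:R :> K by rewrite ltr0n ltnW.
pose Q : K := q%:R ^+ r.
have Q0 : 0 < Q by rewrite exprn_gt0.
have xQ : x * Q = r%:R by rewrite /x divfK // gt_eqF.
have yQ : y * Q = 1 by rewrite /y exprVn mulVf // gt_eqF.
have y0 : 0 < y by rewrite exprn_gt0 // invr_gt0.
have x0 : 0 < x by rewrite divr_gt0 ?ltr0n.
have QE : Q = (q ^ r)%:R by rewrite natrX.
have leQn : Q <= n%:R by rewrite QE ler_nat; nia.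
have N0 : 0 < n%:R :> K by exact: lt_le_trans Q0 leQn.
have leNX : n%:R / Q <= X.
  rewrite ler_pdivrMr //.
  have -> : X * Q = (R * (q ^ r.+1 + r.+1.*2))%:R.
    rewrite /X -mulrA natrM; congr (_ * _).
    have -> : (q%:R + 2 * x + 2 * y) * Q = q%:R * Q + 2 * (x * Q) + 2 * (y * Q).
      by ring.
    rewrite xQ yQ natrD natrX exprS -/Q -muln2 natrM -natr1; ring.
  by rewrite ler_nat ltnW.
have smallN : ((R + 3) * r < n)%N.
  rewrite -(ltr_nat K); apply: lt_le_trans leQn.
  by rewrite natrM -xQ mulrA -[ltRHS]mul1r (ltr_pM2r Q0).
pose P := (n - (R + 3) * r)%N.
pose p : K := P%:R.
have P0 : (0 < P)%N by rewrite subn_gt0.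
have p0 : 0 < p by rewrite ltr0n.
have pE : p = n%:R - (R + 3)%:R * r%:R by rewrite /p natrB ?natrM // ltnW.
have leNp : n%:R / p <= (1 - (R + 3)%:R * x)^-1.
  rewrite ler_pdivrMr // ler_pdivlMl ?subr_gt0 // pE mulrBl mul1r lerD2l lerN2.
  by rewrite -xQ mulrA ler_wpM2l // mulr_ge0 // ltW.
pose D : K := q%:R ^+ (n - R * r).
have D0 : 0 < D by rewrite exprn_gt0.
have leRr : (R * r <= n)%N by apply: leq_trans len; rewrite leq_mul2l; lia.
have DE : q%:R ^+ n = D * Q ^+ R by rewrite -exprM mulnC -exprD subnK.
have PE : D = q%:R ^+ P * Q ^+ 3.
  by rewrite -exprM -exprD /D; congr (_ ^+ _); rewrite /P; nia.
set L := min_covering_length q n R.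
have leL : L%:R <= D * (1 + n%:R / p + n%:R * p / Q ^+ 3).
  have := min_covering_length_bound P q1 R0 r0 len.
  rewrite -/L -(ler_nat K) !(natrM, natrD, natrX) -/p -/D => h.
  rewrite -(ler_pM2l p0); apply: le_trans h _; rewrite le_eqVlt; apply/orP; left.
  by apply/eqP; rewrite PE; field; rewrite !gt_eqF.
have -> : L%:R * n%:R ^+ R / q%:R ^+ n = (n%:R / Q) ^+ R * (L%:R / D) :> K.
  rewrite DE expr_div_n; have := exprn_gt0 R Q0; move: (Q ^+ R) => b b0.
  by field; rewrite !gt_eqF.
have NQ0 : 0 <= n%:R / Q by rewrite divr_ge0 // ltW.
apply: ler_pM; rewrite ?exprn_ge0 // ?divr_ge0 ?(ltW D0) //.
  by rewrite lerXn2r // nnegrE (le_trans NQ0).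
rewrite ler_pdivrMr // [leRHS]mulrC; apply: le_trans leL _.
rewrite ler_pM2l // lerD // ?lerD2l //.
have -> : n%:R * p / Q ^+ 3 = (n%:R / Q) * (p / Q) * y.
  by rewrite -[y](mulfK (lt0r_neq0 Q0)) yQ; field; rewrite gt_eqF.
rewrite ler_pM2r // expr2 ler_pM ?divr_ge0 ?(ltW p0) ?(ltW Q0) //.
apply: le_trans leNX; rewrite ler_pM2r ?invr_gt0 // pE lerBlDr lerDl mulr_ge0 //.
Qed.

(** Exponentials outgrow quadratics, so the quotient is at most
    [4 / r.+1]. *)
Lemma nat_over_exp_cvg0 (K : realType) (q : nat) :
  (1 < q)%N -> (r%:R / q%:R ^+ r : K) @[r --> \oo] --> (0 : K).
Proof.
move=> q1.
have quad r : (r * r.+1 <= 4 * q ^ r)%N.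
  apply: (@leq_trans (4 * 2 ^ r)); last first.
    by case: r => // r; rewrite leq_mul2l leq_exp2r.
  by elim: r => [|[|[|r]] IH] //; rewrite expnS; nia.
apply: (@squeeze_cvgr _ _ _ _ (fun=> 0) (fun r => 4 * harmonic r)).
- near=> r; have qr0 : 0 < q%:R ^+ r :> K by rewrite exprn_gt0 // ltr0n ltnW.
  rewrite divr_ge0 ?(ltW qr0) //= ler_pdivrMr // mulrAC ler_pdivlMr //.
  by rewrite -natrM -natrX -natrM ler_nat.
- exact: cvg_cst.
- rewrite -[X in _ --> X](mulr0 4); apply: cvgMr; exact: cvg_harmonic.
Unshelve. all: by end_near.
Qed.

Lemma density_majorant_cvg (K : realType) (q R : nat) :
  (1 < q)%N ->
  density_majorant K q R r @[r --> \oo] --> (2 * (R%:R * q%:R) ^+ R : K).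
Proof.
move=> q1; rewrite /density_majorant.
have hx := (@nat_over_exp_cvg0 K q q1).
have hy : ((q%:R : K)^-1 ^+ r) @[r --> \oo] --> (0 : K).
  apply: cvg_expr; rewrite ger0_norm ?invr_ge0 // invf_lt1 ?ltr1n // ltr0n ltnW //.
have hX : (R%:R * (q%:R + 2 * (r%:R / q%:R ^+ r) + 2 * q%:R^-1 ^+ r) : K)
    @[r --> \oo] --> (R%:R * q%:R : K).
  have -> : R%:R * q%:R = R%:R * (q%:R + 2 * 0 + 2 * 0) :> K.
    by rewrite !mulr0 !addr0.
  apply: cvgM; first exact: cvg_cst.
  apply: cvgD; last by apply: cvgM; [exact: cvg_cst | exact: hy].
  apply: cvgD; first exact: cvg_cst.
  by apply: cvgM; [exact: cvg_cst | exact: hx].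
have powX k : ((R%:R * (q%:R + 2 * (r%:R / q%:R ^+ r) + 2 * q%:R^-1 ^+ r) : K) ^+ k)
    @[r --> \oo] --> ((R%:R * q%:R) ^+ k : K).
  by apply: (cvg_comp _ (fun z : K => z ^+ k) hX); exact: (@exprn_continuous K k).
have -> : 2 * (R%:R * q%:R) ^+ R = (R%:R * q%:R) ^+ R
    * (1 + (1 - (R + 3)%:R * 0)^-1 + (R%:R * q%:R) ^+ 2 * 0) :> K.
  by rewrite !mulr0 subr0 invr1 addr0 mulrC.
apply: cvgM; first exact: powX.
apply: cvgD; last by apply: cvgM; [exact: powX | exact: hy].
apply: cvgD; first exact: cvg_cst.
apply: cvgV; first by rewrite mulr0 subr0 oner_neq0.
apply: cvgB; first exact: cvg_cst.
by apply: cvgM; [exact: cvg_cst | exact: hx].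
Qed.

Lemma exists_block_exponent (q R r0 n : nat) :
  (1 < q)%N -> (0 < R)%N -> (R * (q ^ r0 + r0.*2) <= n)%N ->
  exists2 r, (r0 <= r)%N &
    (R * (q ^ r + r.*2) <= n)%N && (n < R * (q ^ r.+1 + r.+1.*2))%N.
Proof.
move=> q1 R0 hn; pose Pr r := (R * (q ^ r + r.*2) <= n)%N.
have exP : exists r, Pr r by exists r0.
have ubP r : Pr r -> (r <= n)%N.
  by apply: leq_trans; have := ltn_expl r q1; nia.
have [r hr rmax] := ex_maxnP exP ubP.
exists r; first exact: rmax.
rewrite [X in X && _]hr ltnNge; apply/negP => /rmax; rewrite ltnn //.
Qed.

Lemma density_eventually_le (K : realType) (q R : nat) (c : K) :
  (1 < q)%N -> (0 < R)%N -> 2 * (R%:R * q%:R) ^+ R < c ->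
  \forall n \near \oo,
    (min_covering_length q n R)%:R * n%:R ^+ R / q%:R ^+ n <= c.
Proof.
move=> q1 R0 hc.
have : \forall r \near \oo, density_majorant K q R r <= c.
  exact: cvgr_le (@density_majorant_cvg K q R q1) _ hc.
have : \forall r \near \oo, (R + 3)%:R * (r%:R / q%:R ^+ r) < 1 :> K.
  apply: (@cvgr_lt K _ _ _ _ ((R + 3)%:R * 0)); last by rewrite mulr0.
  by apply: cvgM; [exact: cvg_cst | exact: nat_over_exp_cvg0].
move=> [N1 _ h1] [N2 _ h2]; pose r0 := maxn 1 (maxn N1 N2).
exists (R * (q ^ r0 + r0.*2))%N => // n /= hn.
have [r ler /andP[len ltn]] := exists_block_exponent q1 R0 hn.
have [r1 N1r N2r] : [/\ 0 < r, N1 <= r & N2 <= r]%N.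
  by move: ler; rewrite /r0 !geq_max => /and3P[].
by apply: le_trans (h2 _ N2r); apply: density_le_majorant => //; apply: h1.
Qed.

Lemma ffact_le_expn (n m : nat) : (n ^_ m <= n ^ m)%N.
Proof.
by elim: m => [|m IH] //; rewrite ffactnSr expnSr leq_mul // leq_subr.
Qed.

(** The term of index [R] gives the leading coefficient since
    ['C(n, R) * R! <= n ^ R]; the [R] other ones are at most
    [n ^ R.-1 * (q - 1) ^ R], and [1 / n <= 2 / n.+1]. *)
Lemma hamming_ball_size_le (K : realType) (q R n : nat) :
  (1 < q)%N -> (0 < R)%N -> (0 < n)%N ->
  (hamming_ball_size q n R)%:R
    <= n%:R ^+ R * ((q%:R - 1) ^+ R / R`!%:R
                    + 2 * R%:R * (q%:R - 1) ^+ R * harmonic n) :> K.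
Proof.
move=> q1 R0 n0; pose c : K := (q%:R - 1) ^+ R.
have qE : (q - 1)%:R = q%:R - 1 :> K by rewrite natrB // ltnW.
have qge1 : 1 <= q%:R - 1 :> K by rewrite -qE ler1n subn_gt0.
have c0 : 0 <= c by rewrite exprn_ge0 // (le_trans ler01).
have N0 : 0 < n%:R :> K by rewrite ltr0n.
rewrite /hamming_ball_size big_ord_recr /= natrD addrC mulrDr lerD //.
  rewrite natrM natrX qE -/c mulrCA mulrC ler_wpM2l //.
  rewrite ler_pdivlMr ?ltr0n ?fact_gt0 // -natrM bin_ffact -natrX ler_nat.
  exact: ffact_le_expn.
rewrite natr_sum.
apply: (@le_trans _ _ (\sum_(j < R) n%:R ^+ R.-1 * c)).
  apply: ler_sum => j _; rewrite natrM natrX qE; apply: ler_pM => //.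
    - exact/exprn_ge0/(le_trans ler01).
    - rewrite -natrX ler_nat; apply: (@leq_trans (n ^ j)).
      apply: leq_trans (ffact_le_expn n j); rewrite -bin_ffact leq_pmulr ?fact_gt0 //.
    by rewrite leq_pexp2l //; have := ltn_ord j; lia.
    - by apply: ler_weXn2l => //; apply: ltnW.
rewrite sumr_const card_ord -[_ *+ R]mulr_natr.
have -> : n%:R ^+ R = n%:R * n%:R ^+ R.-1 :> K by rewrite -exprS prednK.
have -> : n%:R * n%:R ^+ R.-1 * (2 * R%:R * (q%:R - 1) ^+ R * harmonic n)
  = n%:R ^+ R.-1 * c * R%:R * (2 * n%:R / n.+1%:R) :> K.
  by rewrite /harmonic /= -/c; ring.
apply: ler_peMr; first by rewrite !mulr_ge0 // exprn_ge0.
rewrite ler_pdivlMr // mul1r -natrM ler_nat; lia.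
Qed.

Theorem mainTheorem1 (K : realType) (q R : nat) (hq : (2 <= q)%N)
    (hR : (1 <= R)%N) :
  (exists2 e : nat -> K, e n @[n --> \oo] --> (0 : K) &
    forall n : nat, (1 <= n)%N ->
      (min_covering_length q n R)%:R
        <= (2 * q%:R ^+ R * R%:R ^+ R.+1 + e n) * (q%:R ^+ n / n%:R ^+ R))
  /\
  (exists2 e : nat -> K, e n @[n --> \oo] --> (0 : K) &
    forall n : nat, (1 <= n)%N ->
      (min_covering_length q n R)%:R
        <= (2 * q%:R ^+ R * (q%:R - 1) ^+ R * R%:R ^+ R.+1 / R`!%:R + e n)
           * (q%:R ^+ n / (hamming_ball_size q n R)%:R)).
Proof.
set A := 2 * _ * _.
have q0 : 0 < q%:R :> K by rewrite ltr0n ltnW.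
have leA : 2 * (R%:R * q%:R) ^+ R <= A.
  have -> : A = 2 * (R%:R * q%:R) ^+ R * R%:R by rewrite /A exprMn exprSr; ring.
  by rewrite ler_peMr ?ler1n // mulr_ge0 ?exprn_ge0 ?mulr_ge0 // ltW.
have A0 : 0 <= A by apply: le_trans leA; rewrite mulr_ge0 ?exprn_ge0 ?mulr_ge0 // ltW.
pose v n : K := (min_covering_length q n R)%:R * n%:R ^+ R / q%:R ^+ n.
(* Only an upper bound on [v] is available, so the error term is its positive
   excess over [A]. *)
pose e n := Num.max 0 (v n - A).
have e0 : e n @[n --> \oo] --> (0 : K).
  apply/cvgrPdist_le => eps eps0.
  have hc : 2 * (R%:R * q%:R) ^+ R < A + eps.
    by apply: le_lt_trans leA _; rewrite ltrDl.
  have := density_eventually_le hq hR hc; apply: filterS => n hn.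
  rewrite sub0r normrN ger0_norm ?le_max ?lexx // /e ge_max ltW //=.
  by rewrite lerBlDl.
have ve n : v n <= A + e n by rewrite -lerBlDl /e le_max lexx orbT.
have bound1 n : (1 <= n)%N -> (min_covering_length q n R)%:R
    <= (A + e n) * (q%:R ^+ n / n%:R ^+ R).
  move=> n0; have nR0 : 0 < n%:R ^+ R :> K by rewrite exprn_gt0 // ltr0n.
  rewrite mulrA ler_pdivlMr // -ler_pdivrMr ?exprn_gt0 //; exact: ve.
split; first by exists e.
pose A' := A * ((q%:R - 1) ^+ R / R`!%:R).
have -> : 2 * q%:R ^+ R * (q%:R - 1) ^+ R * R%:R ^+ R.+1 / R`!%:R = A'.
  by rewrite /A' /A; ring.
pose w n : K := (q%:R - 1) ^+ R / R`!%:R + 2 * R%:R * (q%:R - 1) ^+ R * harmonic n.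
exists (fun n => (A + e n) * w n - A').
  have -> : 0 = (A + 0) * ((q%:R - 1) ^+ R / R`!%:R
                 + 2 * R%:R * (q%:R - 1) ^+ R * 0) - A'.
    by rewrite mulr0 !addr0 subrr.
  apply: cvgB; last exact: cvg_cst.
  apply: cvgM; first by apply: cvgD; [exact: cvg_cst | exact: e0].
  apply: cvgD; first exact: cvg_cst.
  by apply: cvgM; [exact: cvg_cst | exact: cvg_harmonic].
move=> n n0; rewrite addrC subrK; apply: le_trans (bound1 n n0) _.
have nR0 : 0 < n%:R ^+ R :> K by rewrite exprn_gt0 // ltr0n.
have V0 : 0 < (hamming_ball_size q n R)%:R :> K.
  by rewrite ltr0n /hamming_ball_size big_ord_recl /= bin0 mul1n expn0.
rewrite -mulrA ler_wpM2l //; first by rewrite addr_ge0 // /e le_max lexx.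
rewrite mulrCA ler_wpM2l ?exprn_ge0 ?(ltW q0) //.
rewrite ler_pdivlMr // ler_pdivrMl //.
exact: hamming_ball_size_le.
Qed.
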